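(* Define the sequence $(a_k)_{k=1}^{\infty}$ recursively by $$a_k=(-1)^{k-1}\left(\frac{4^k k}{(2k)!}+\sum_{\ell=1}^{k-1}\frac{(-1)^{\ell}4^{k-\ell}}{(2k-2\ell)!}\,a_\ell\right),\qquad k\ge 1,$$ where the empty sum (for $k=1$) is $0$, so that $a_1=2$. Then for every integer $k\ge 1$ the following three statements hold. (i) The function of the positive integer $n$ $$P_k(n)=\sum_{\ell=1}^{n}\left(\cot\left(\frac{2\ell-1}{4n}\pi\right)\right)^{2k}$$ equals a polynomial in $n$ of degree $2k$ with leading coefficient $a_k$; that is, there is a polynomial $p_k$ with real coefficients, of degree $2k$ and leading coefficient $a_k$, such that $P_k(n)=p_k(n)$ for all integers $n\ge 1$. (ii) The function of the positive integer $n$ $$Q_k(n)=\sum_{\ell=1}^{n}\left(\sin\left(\frac{2\ell-1}{4n}\pi\right)\right)^{-2k}$$ equals a polynomial in $n$ of degree $2k$ with leading coefficient $a_k$; that is, there is a polynomial $q_k$ with real coefficients, of degree $2k$ and leading coefficient $a_k$, such that $Q_k(n)=q_k(n)$ for all integers $n\ge 1$. (iii) $$\zeta(2k)=\frac{\pi^{2k}}{4^{2k}-4^{k}}\,a_k.$$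
   Context: For a positive integer $k$, $\zeta(2k)=\sum_{\ell=1}^{\infty}\ell^{-2k}$. *)

(* Defs.v *)
From mathcomp Require Import all_boot all_order all_algebra.
From mathcomp Require Import all_classical all_reals all_analysis.

Set Implicit Arguments.
Unset Strict Implicit.
Unset Printing Implicit Defensive.

Import Order.TTheory GRing.Theory Num.Theory.

Local Open Scope ring_scope.

Definition cot {R : realType} (x : R) : R := cos x / sin x.

(* The value is an extended real: the terms are nonnegative, so the series
   always has a sum in [\bar R], and an equality [zeta R s = x%:E] with [x : R]
   says that the series converges in R with sum x. *)
Definition zeta (R : realType) (s : nat) : \bar R :=
  (\sum_(1 <= l <oo) ((l%:R : R) ^- s)%:E)%E.

(* Main.v *)
Require Import Defs.
From mathcomp Require Import all_boot all_order all_algebra.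
From mathcomp Require Import all_classical all_reals all_analysis.
From mathcomp Require Import ring lra zify.

Import Order.TTheory GRing.Theory Num.Theory.
Import numFieldNormedType.Exports.

Local Open Scope ring_scope.

(** Write theta_l = (2l-1) pi / 4n for 1 <= l <= n. Expanding cos (2n x) by
    de Moivre gives cos (2n x) = cos^(2n) x * G (tan^2 x), where
    G = sum_j (-1)^j C(2n, 2j) X^j. Since cos (2n theta_l) = 0, the n distinct
    numbers tan^2 theta_l are roots of G, whose degree is at most n and whose
    constant term is 1; hence G = prod_l (1 - cot^2 theta_l X)
    ([cos_tan2_poly_factor]). In other words the j-th elementary symmetric
    function of the cot^2 theta_l is C(2n, 2j), a polynomial in n of degree 2j
    with leading coefficient 4^j / (2j)!. Newton's identities then express the
    power sum P_k(n) through the earlier ones ([cot_sum_rec]), and comparing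
    coefficients of n^(2k) turns them into the recursion that defines a_k
    ([polynomial_cot_sum]). Since 1 / sin^2 = 1 + cot^2, Q_k is the sum of the
    C(k, j) P_j, where only j = k reaches degree 2k ([polynomial_csc_sum]).

    For the zeta value, cot x <= 1 / x <= 1 / sin x on ]0, pi/2[, so the sum of
    the theta_l^(-2k), which is (4n / pi)^(2k) times the n-th partial sum of
    1 + 3^(-2k) + 5^(-2k) + ..., lies between P_k(n) and Q_k(n). Divided by
    n^(2k), both tend to a_k, hence the sum over odd integers is
    (pi / 4)^(2k) a_k ([odd_zeta_sum_cvg]); it equals (1 - 4^(-k)) zeta(2k).
    As it is at least 1, a_k is nonzero, and therefore the polynomials have
    degree exactly 2k. *)

Set Implicit Arguments.
Unset Strict Implicit.
Unset Printing Implicit Defensive.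

(** * Newton's identities *)

(** A convolution with the coefficients of (1 - y X) p is the one with those of
    p minus y times the one a step shorter; applied to power sums and to powers
    of y, this drives the induction behind Newton's identities. *)
Lemma coef_conv_1subX (K : comNzRingType) (p : {poly K}) (y : K)
    (u : nat -> K) (k : nat) :
  \sum_(1 <= l < k.+2) ((1 - y *: 'X) * p)`_(k.+1 - l) * u l =
  \sum_(1 <= l < k.+2) p`_(k.+1 - l) * u l -
  y * \sum_(1 <= l < k.+1) p`_(k - l) * u l.
Proof.
have coefE m : ((1 - y *: 'X) * p)`_m.+1 = p`_m.+1 - y * p`_m.
  by rewrite mulrBl mul1r -scalerAl coefB coefZ coefXM.
rewrite big_nat_recr //= [in RHS]big_nat_recr //= subnn.
have -> : ((1 - y *: 'X) * p)`_0 = p`_0.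
  by rewrite mulrBl mul1r -scalerAl coefB coefZ coefXM mulr0 subr0.
rewrite addrAC mulr_sumr -sumrB; congr (_ + _).
apply: eq_big_nat => l /andP[_ lk].
by rewrite subSn // coefE mulrBl mulrA.
Qed.

(** The coefficient of X^j in this product is (-1)^j times the j-th elementary
    symmetric function of [s], so these are Newton's identities. A further
    factor 1 - y X adds a telescoping convolution with the powers of y. *)
Lemma newton_identity (K : comNzRingType) (s : seq K) (k : nat) :
  k%:R * (\prod_(x <- s) (1 - x *: 'X))`_k =
  - \sum_(1 <= l < k.+1)
      (\prod_(x <- s) (1 - x *: 'X))`_(k - l) * \sum_(x <- s) x ^+ l.
Proof.
elim: s k => [|y s IHs] [|k]; try by rewrite mul0r big_geq ?oppr0.
  rewrite [X in - X]big1 => [|l _]; last by rewrite [X in _ * X]big_nil mulr0.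
  by rewrite big_nil coef1 mulr0 oppr0.
rewrite big_cons; set F := \prod_(x <- s) _ in IHs *.
under eq_bigr do rewrite big_cons mulrDr.
rewrite big_split /= !coef_conv_1subX.
have := IHs k.+1; have := IHs k.
set A := \sum_(1 <= l < k.+1) _; set B := \sum_(1 <= l < k.+2) _.
move=> hA hB.
have tele : \sum_(1 <= l < k.+2) F`_(k.+1 - l) * y ^+ l =
    F`_k * y + y * \sum_(1 <= l < k.+1) F`_(k - l) * y ^+ l.
  rewrite big_ltn // subSS subn0 expr1; congr (_ + _).
  rewrite big_add1 mulr_sumr; apply: eq_bigr => l _.
  by rewrite subSS exprS mulrCA.
rewrite tele addrK mulrBl mul1r -scalerAl coefB coefZ coefXM /=.
have -> : A = - (k%:R * F`_k) by rewrite hA opprK.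
have -> : B = - (k.+1%:R * F`_k.+1) by rewrite hB opprK.
by rewrite -natr1; ring.
Qed.

(** The difference of the two sides vanishes at the inverses of the elements of
    [s] and at 0, which is more points than its degree allows. Taking 0 as a
    root is what fixes the scalar factor. *)
Lemma prod_1subX (K : fieldType) (s : seq K) (p : {poly K}) :
  uniq s -> 0 \notin s -> (size p <= (size s).+1)%N -> p`_0 = 1 ->
  {in s, forall x, root p x^-1} -> p = \prod_(x <- s) (1 - x *: 'X).
Proof.
move=> us s0 sp p0 rp; set q := \prod_(x <- s) _.
apply/eqP; rewrite -subr_eq0; apply/eqP.
have sq : (size q <= (size s).+1)%N.
  rewrite /q; elim: (s) => [|x t IHt]; first by rewrite big_nil size_poly1.
  rewrite big_cons (leq_trans (size_polyMleq _ _)) //=.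
  have : (size (1 - x *: 'X : {poly K})%R <= 2)%N.
    rewrite (leq_trans (size_polyD _ _)) // geq_max size_poly1 size_polyN.
    by rewrite (leq_trans (size_scale_leq _ _)) // size_polyX.
  by move=> h; rewrite -subn1 leq_subLR add1n; apply: (leq_add h IHt).
apply: (@roots_geq_poly_eq0 _ _ (0 :: map GRing.inv s)).
- rewrite /= rootE hornerD hornerN !horner_coef0 p0 /q -horner_coef0.
  rewrite horner_prod big1 ?subrr ?eqxx /= => [|x _]; last first.
    by rewrite !hornerE ?mulr0 ?subr0.
  apply/allP => _ /mapP[x xs ->].
  rewrite rootE hornerD hornerN (rootP (rp x xs)) sub0r oppr_eq0 horner_prod.
  rewrite (big_rem x) //= !hornerE divff ?subrr ?mul0r //.
  by apply: contraNneq s0 => <-.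
- rewrite /= map_inj_uniq ?us ?andbT; last exact: invr_inj.
  by apply: contra s0 => /mapP[x xs /eqP]; rewrite eq_sym invr_eq0 => /eqP <-.
- rewrite /= size_map (leq_trans (size_polyD _ _)) // size_polyN geq_max sp sq.
  by [].
Qed.

(** * Expansion of cos (2n x) *)

(** De Moivre's formula without complex numbers: the phase [phi] makes the
    induction go through, since - sin t = cos (t + pi / 2) turns both terms of
    the addition formula into cosines of the previous rank. *)
Lemma cosMn_shift (R : realType) (x phi : R) (m : nat) :
  cos (m%:R * x + phi) =
  \sum_(j < m.+1) 'C(m, j)%:R * (cos x ^+ (m - j) * sin x ^+ j) *
    cos (phi + j%:R * (pi / 2)).
Proof.
elim: m phi => [|m IHm] phi.
  by rewrite big_ord1 bin0 !expr0 !mul0r addr0 add0r !mul1r.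
have -> : m.+1%:R * x + phi = x + (m%:R * x + phi) by rewrite -natr1; ring.
(* The remaining equality of sums is Pascal's rule. *)
rewrite cosD -[sin (_ + phi)]opprK -cosDpihalf -addrA !IHm mulrN opprK.
rewrite [RHS]big_ord_recl bin0.
under [in RHS]eq_bigr => i _ do
  rewrite lift0 binS natrD subSS [X in X * cos _]mulrDl mulrDl.
rewrite big_split /= addrA; congr (_ + _).
  rewrite mulr_sumr big_ord_recl big_ord_recr /= (bin_small (leqnn m.+1)).
  rewrite !mul0r !addr0.
  rewrite bin0 !subn0; congr (_ + _); first by rewrite exprS; ring.
  apply: eq_bigr => i _; rewrite /bump leq0n add1n.
  have -> : (m - i = (m - i.+1).+1)%N by have := ltn_ord i; lia.
  by rewrite !exprS; ring.
rewrite mulr_sumr; apply: eq_bigr => i _.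
have -> : phi + pi / 2 + i%:R * (pi / 2) = phi + i.+1%:R * (pi / 2).
  by rewrite -natr1; ring.
by rewrite exprS; ring.
Qed.

Lemma sum_even (V : nmodType) (F : nat -> V) (n : nat) :
  (forall j, odd j -> F j = 0) ->
  \sum_(j < (2 * n).+1) F j = \sum_(j < n.+1) F (2 * j)%N.
Proof.
move=> F0; elim: n => [|n IHn]; first by rewrite !big_ord1.
have E2 : (2 * n.+1 = (2 * n).+2)%N by rewrite mulnS add2n.
rewrite [RHS]big_ord_recr /= -IHn E2 2!big_ord_recr /=.
by rewrite [F (2 * n).+1]F0 ?addr0 //= oddM.
Qed.

Lemma cosMpi (R : realType) (j : nat) : cos (j%:R * pi) = (-1) ^+ j :> R.
Proof.
elim: j => [|j IHj]; first by rewrite mul0r cos0.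
by rewrite -natr1 mulrDl mul1r cosDpi IHj exprS mulN1r.
Qed.

Lemma sinMpi (R : realType) (j : nat) : sin (j%:R * pi) = 0 :> R.
Proof.
elim: j => [|j IHj]; first by rewrite mul0r sin0.
by rewrite -natr1 mulrDl mul1r sinDpi IHj oppr0.
Qed.

Lemma cosM2n (R : realType) (x : R) (n : nat) :
  cos ((2 * n)%:R * x) =
  \sum_(j < n.+1) (-1) ^+ j * 'C(2 * n, 2 * j)%:R *
     (cos x ^+ (2 * n - 2 * j) * sin x ^+ (2 * j)).
Proof.
rewrite -[_ * x]addr0 cosMn_shift.
pose F j : R := 'C(2 * n, j)%:R * (cos x ^+ (2 * n - j) * sin x ^+ j) *
    cos (0 + j%:R * (pi / 2)).
rewrite (@sum_even _ F) => [|j oj]; rewrite /F ?add0r.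
  apply: eq_bigr => j _; rewrite ?add0r.
  have -> : (2 * j)%:R * (pi / 2) = j%:R * pi :> R by rewrite natrM; field.
  by rewrite cosMpi; ring.
(* Odd indices contribute cos of an odd multiple of pi / 2. *)
have -> : j%:R * (pi / 2) = j./2%:R * pi + pi / 2 :> R.
  by rewrite -{1}(odd_double_half j) oj natrD -mul2n natrM /=; field.
by rewrite cosDpihalf sinMpi oppr0 mulr0.
Qed.

(** * Polynomial functions of a positive integer *)

(** Only an upper bound on the degree is required, so that [c] may vanish: this
    makes the notion closed under sums, products and raising of [d], with [c]
    computed along the way, and the exact degree is recovered at the end from
    [c != 0]. *)
Definition polynomial_fun (K : idomainType) (d : nat) (c : K) (f : nat -> K) :=
  exists p : {poly K},
    [/\ (size p <= d.+1)%N, p`_d = c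
      & forall n : nat, (1 <= n)%N -> f n = p.[n%:R]].

Section PolynomialFun.
Context {K : idomainType}.
Implicit Types (c : K) (f g : nat -> K) (d : nat).

Lemma eq_polynomial_fun d c f g :
  (forall n, (1 <= n)%N -> f n = g n) ->
  polynomial_fun d c f -> polynomial_fun d c g.
Proof.
by move=> fg [p [sp pd pf]]; exists p; split=> // n n1; rewrite -fg ?pf.
Qed.

Lemma polynomial_fun_cst c : polynomial_fun 0 c (fun=> c).
Proof.
exists c%:P; split; rewrite ?coefC //; last by move=> n _; rewrite hornerC.
by rewrite size_polyC leq_b1.
Qed.

Lemma polynomial_fun_id : polynomial_fun 1 (1 : K) (fun n => n%:R).
Proof.
by exists 'X; split; rewrite ?size_polyX ?coefX // => n _; rewrite hornerX.
Qed.

Lemma polynomial_funD d c1 c2 f g :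
  polynomial_fun d c1 f -> polynomial_fun d c2 g ->
  polynomial_fun d (c1 + c2) (fun n => f n + g n).
Proof.
move=> [p [sp <- pf]] [q [sq <- qg]]; exists (p + q); split.
- by rewrite (leq_trans (size_polyD _ _)) // geq_max sp sq.
- by rewrite coefD.
- by move=> n n1; rewrite hornerD pf ?qg.
Qed.

Lemma coefM_top (p q : {poly K}) d e :
  (size p <= d.+1)%N -> (size q <= e.+1)%N -> (p * q)`_(d + e) = p`_d * q`_e.
Proof.
move=> sp sq; have dlt : (d < (d + e).+1)%N by rewrite ltnS leq_addr.
rewrite coefM (bigD1 (Ordinal dlt)) //= addKn big1 ?addr0 // => i ne_id.
have [lt_id|lt_di|eq_id] := ltngtP i d.
- by rewrite [q`__]nth_default ?mulr0 // (leq_trans sq) //; lia.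
- by rewrite [p`__]nth_default ?mul0r // (leq_trans sp).
- by case/eqP: ne_id; apply: val_inj.
Qed.

Lemma polynomial_funM d e c1 c2 f g :
  polynomial_fun d c1 f -> polynomial_fun e c2 g ->
  polynomial_fun (d + e) (c1 * c2) (fun n => f n * g n).
Proof.
move=> [p [sp <- pf]] [q [sq <- qg]]; exists (p * q); split.
- apply: leq_trans (size_polyMleq _ _) _.
  by rewrite -subn1 leq_subLR add1n -addSn -addnS leq_add.
- exact: coefM_top.
- by move=> n n1; rewrite hornerM pf ?qg.
Qed.

Lemma polynomial_funZ d a c f :
  polynomial_fun d c f -> polynomial_fun d (a * c) (fun n => a * f n).
Proof. exact: (polynomial_funM (polynomial_fun_cst a)). Qed.

Lemma polynomial_fun_sum (I : eqType) (r : seq I) d (c : I -> K)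
    (f : I -> nat -> K) :
  {in r, forall i, polynomial_fun d (c i) (f i)} ->
  polynomial_fun d (\sum_(i <- r) c i) (fun n => \sum_(i <- r) f i n).
Proof.
elim: r => [|i r IHr] fr.
  exists 0; split; rewrite ?size_poly0 ?coef0 ?big_nil // => n _.
  by rewrite big_nil horner0.
rewrite big_cons; apply: (@eq_polynomial_fun _ _
  (fun n => f i n + \sum_(j <- r) f j n)) => [n _|]; first by rewrite big_cons.
apply: polynomial_funD; first by apply: fr; rewrite mem_head.
by apply: IHr => j jr; apply: fr; rewrite in_cons jr orbT.
Qed.

Lemma polynomial_funW d e c f :
  (d < e)%N -> polynomial_fun d c f -> polynomial_fun e 0 f.
Proof.
move=> lt_de [p [sp _ pf]]; exists p; split=> //.
  by rewrite (leq_trans sp) // ltnS ltnW.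
by rewrite nth_default // (leq_trans sp).
Qed.

End PolynomialFun.

(** (2n)^_m is the product of the 2n - i for i < m. The truncated subtractions
    are harmless: when one occurs, the product already contains the factor 0. *)
Lemma polynomial_fun_ffact (K : idomainType) (m : nat) :
  polynomial_fun m (2 ^+ m : K) (fun n => ((2 * n) ^_ m)%:R).
Proof.
elim: m => [|m IHm].
  apply: eq_polynomial_fun (polynomial_fun_cst _) => n _.
  by rewrite ffactn0.
have lin : polynomial_fun 1 (2 : K) (fun n => 2 * n%:R - m%:R).
  rewrite -[X in polynomial_fun _ X _]addr0 -[X in X + 0]mulr1.
  apply: polynomial_funD; first exact/polynomial_funZ/polynomial_fun_id.
  by apply: polynomial_funW (polynomial_fun_cst _).
rewrite exprSr -addn1; apply: eq_polynomial_fun (polynomial_funM IHm lin).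
move=> n _; rewrite addn1 ffactnSr natrM.
have [lt_nm|le_mn] := ltnP (2 * n) m; first by rewrite ffact_small // !mul0r.
by rewrite natrB // natrM.
Qed.

Lemma polynomial_fun_bin (K : numFieldType) (m : nat) :
  polynomial_fun m (2 ^+ m / m`!%:R : K) (fun n => 'C(2 * n, m)%:R).
Proof.
rewrite mulrC.
have binE := polynomial_funZ (m`!%:R)^-1 (polynomial_fun_ffact K m).
apply: eq_polynomial_fun binE.
move=> n _; rewrite -bin_ffact natrM mulrCA mulVf ?mulr1 //.
Qed.

(** f(n) / n^d is the value at 1/n of the polynomial with reversed coefficients,
    whose constant term is [c]. *)
Lemma polynomial_fun_cvg (R : realType) (d : nat) (c : R) (f : nat -> R) :
  polynomial_fun d c f ->
  ((fun n => f n.+1 / n.+1%:R ^+ d) @ \oo --> c)%classic.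
Proof.
move=> [p [sp <- pf]].
pose q := \poly_(i < d.+1) p`_(d - i).
have -> : (fun n => f n.+1 / n.+1%:R ^+ d) = (fun n => q.[harmonic n]).
  apply/funext => n; rewrite pf // (horner_coef_wide _ sp) horner_poly.
  rewrite mulr_suml (reindex_inj rev_ord_inj) /=; apply: eq_bigr => i _.
  rewrite subSS -mulrA /harmonic exprVn; congr (_ * _).
  have le_id : (i <= d)%N by rewrite -ltnS.
  have -> : n.+1%:R ^+ d = n.+1%:R ^+ (d - i) * n.+1%:R ^+ i :> R.
    by rewrite -exprD subnK.
  rewrite invfM mulrA mulfV ?mul1r //.
have -> : p`_d = q.[0] by rewrite horner_coef0 coef_poly subn0.
exact: (continuous_cvg _ (@continuous_horner _ q 0) cvg_harmonic).
Qed.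

(** * The numbers cot^2 theta_l *)

Definition angle (R : realType) (n l : nat) : R :=
  (2 * l%:R - 1) / (4 * n%:R) * pi.

(** All the angles are strictly in the first quadrant, where the trigonometric
    functions are positive and cot^2 is injective. *)
Lemma angle_itv (R : realType) (n l : nat) :
  (1 <= l)%N -> (l <= n)%N -> 0 < angle R n l < pi / 2.
Proof.
move=> l1 ln; have pi0 := pi_gt0 R.
have lR : (1 : R) <= l%:R by rewrite ler1n.
have lnR : (l%:R : R) <= n%:R by rewrite ler_nat.
have n0 : 0 < 4 * n%:R :> R by lra.
rewrite /angle; apply/andP; split.
  by rewrite mulr_gt0 // divr_gt0 //; lra.
rewrite mulrC ltr_pM2l // ltr_pdivrMr //; lra.
Qed.

Lemma sin_cos_gt0 (R : realType) (x : R) :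
  0 < x < pi / 2 -> 0 < sin x /\ 0 < cos x.
Proof.
move=> /andP[x0 xp]; split; first by rewrite sin_gt0_pihalf // x0.
rewrite cos_gt0_pihalf // xp andbT (lt_trans _ x0) // oppr_lt0.
by rewrite divr_gt0 // pi_gt0.
Qed.

(** 2n theta_l = l pi - pi / 2. *)
Lemma cos_angle (R : realType) (n l : nat) :
  (1 <= n)%N -> cos ((2 * n)%:R * angle R n l) = 0.
Proof.
move=> n1; have n0 : (n%:R : R) != 0 by rewrite pnatr_eq0 -lt0n.
have -> : (2 * n)%:R * angle R n l = l%:R * pi - pi / 2.
  by rewrite /angle natrM; field.
by rewrite cosBpihalf sinMpi.
Qed.

Lemma cot2_inj (R : realType) (x y : R) :
  0 < x < pi / 2 -> 0 < y < pi / 2 -> cot x ^+ 2 = cot y ^+ 2 -> x = y.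
Proof.
move=> xI yI; have [sx cx] := sin_cos_gt0 xI; have [sy cy] := sin_cos_gt0 yI.
move=> /eqP; rewrite eqrXn2 ?divr_ge0 ?ltW // => /eqP /(congr1 GRing.inv).
rewrite /cot !invf_div; apply: tan_inj; rewrite in_itv /=.
  by move/andP: xI => [x0 ->]; rewrite andbT; lra.
by move/andP: yI => [y0 ->]; rewrite andbT; lra.
Qed.

(** The polynomial G with cos (2n x) = cos^(2n) x * G (tan^2 x). *)
Definition cos_tan2_poly (R : realType) (n : nat) : {poly R} :=
  \poly_(j < n.+1) ((-1) ^+ j * 'C(2 * n, 2 * j)%:R).

Lemma coef_cos_tan2_poly (R : realType) (n j : nat) :
  (cos_tan2_poly R n)`_j = (-1) ^+ j * 'C(2 * n, 2 * j)%:R.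
Proof.
rewrite coef_poly; case: ltnP => // lt_nj.
by rewrite bin_small ?mulr0 // ltn_mul2l.
Qed.

Lemma cos_tan2_polyP (R : realType) (n : nat) (x : R) :
  cos x != 0 ->
  cos ((2 * n)%:R * x) = cos x ^+ (2 * n) * (cos_tan2_poly R n).[tan x ^+ 2].
Proof.
move=> cx; rewrite cosM2n horner_poly mulr_sumr; apply: eq_bigr => j _.
have le_jn : (2 * j <= 2 * n)%N by rewrite leq_mul2l -ltnS ltn_ord.
have -> : cos x ^+ (2 * n) = cos x ^+ (2 * n - 2 * j) * cos x ^+ (2 * j).
  by rewrite -exprD subnK.
rewrite /tan -exprM expr_div_n; field.
by rewrite expf_neq0.
Qed.

Lemma cos_tan2_poly_factor (R : realType) (n : nat) : (1 <= n)%N ->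
  cos_tan2_poly R n =
  \prod_(x <- [seq cot (angle R n l) ^+ 2 | l <- index_iota 1 n.+1])
     (1 - x *: 'X).
Proof.
move=> n1.
have itv l : l \in index_iota 1 n.+1 -> 0 < angle R n l < pi / 2.
  by rewrite mem_index_iota ltnS => /andP[l1 ln]; exact: angle_itv.
apply: prod_1subX.
- rewrite map_inj_in_uniq ?iota_uniq // => l m /itv lI /itv mI.
  move=> /(cot2_inj lI mI); have n0 : 0 < n%:R :> R by rewrite ltr0n.
  have pi0 := pi_gt0 R.
  move=> /(mulIf (lt0r_neq0 pi0)) /divIf h.
  have {}h : 2 * l%:R - 1 = 2 * m%:R - 1 :> R.
    by apply: h; rewrite mulf_neq0 ?lt0r_neq0.
  by apply/eqP; rewrite -(eqr_nat R); apply/eqP; lra.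
- apply/mapP => -[l /itv /sin_cos_gt0[s0 c0] /esym /eqP].
  by rewrite expf_eq0 /= mulf_eq0 invr_eq0 !gt_eqF.
- by rewrite size_map size_iota subSS subn0 size_poly.
- by rewrite coef_cos_tan2_poly expr0 mul1r muln0 bin0.
- move=> _ /mapP[l /itv /sin_cos_gt0[s0 c0] ->].
  rewrite -exprVn /cot invf_div -/(tan _) rootE.
  have c0' := lt0r_neq0 c0.
  have := cos_tan2_polyP n c0'; rewrite cos_angle // => /esym /eqP.
  by rewrite mulf_eq0 expf_eq0 (negPf c0') andbF.
Qed.

(** * Power sums of cotangents and cosecants as polynomials *)

Definition cot_sum (R : realType) (k n : nat) : R :=
  \sum_(1 <= l < n.+1) cot (angle R n l) ^+ (2 * k).

Definition csc_sum (R : realType) (k n : nat) : R :=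
  \sum_(1 <= l < n.+1) sin (angle R n l) ^- (2 * k).

(** Newton's identities for the numbers cot^2 theta_l, in the shape of the
    recursion for a_k. *)
Lemma cot_sum_rec (R : realType) (k n : nat) : (1 <= k)%N -> (1 <= n)%N ->
  cot_sum R k n = (-1) ^+ (k - 1) *
    (k%:R * 'C(2 * n, 2 * k)%:R +
     \sum_(1 <= l < k)
        (-1) ^+ l * ('C(2 * n, 2 * k - 2 * l)%:R * cot_sum R l n)).
Proof.
case: k => // k _ n1.
have := newton_identity
  [seq cot (angle R n l) ^+ 2 | l <- index_iota 1 n.+1] k.+1.
rewrite -cos_tan2_poly_factor // big_nat_recr //=.
have pE l : \sum_(x <- [seq cot (angle R n l) ^+ 2 | l <- index_iota 1 n.+1])
    x ^+ l = cot_sum R l n.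
  by rewrite big_map; apply: eq_bigr => i _; rewrite exprM.
rewrite pE subnn subn1 !coef_cos_tan2_poly expr0 mul1r muln0 bin0 mul1r => E.
apply/eqP; rewrite -[X in X == _]opprK eqr_oppLR; apply/eqP.
move: E => /esym /eqP; rewrite opprD addrC subr_eq => /eqP ->.
rewrite exprS mulrDr [in RHS]opprD; congr (_ + _); first by ring.
rewrite mulr_sumr -sumrN; apply: eq_big_nat => l /andP[_ lk].
rewrite pE coef_cos_tan2_poly mulnBr.
have -> : (-1) ^+ (k.+1 - l) = - ((-1) ^+ k * (-1) ^+ l) :> R.
  have -> : (-1) ^+ k = (-1) ^+ (k - l) * (-1) ^+ l :> R.
    by rewrite -exprD subnK.
  by rewrite -mulrA -exprMn mulrNN mulr1 expr1n mulr1 subSn // exprS mulN1r.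
by ring.
Qed.

(** Each product C(2n, 2(k-l)) P_l(n) in the recursion for P_k has degree 2k
    with leading coefficient 4^(k-l) / (2k-2l)! a_l, so the recursion for a_k is
    the one for P_k read on top coefficients. *)
Lemma polynomial_cot_sum (R : realType) (a : nat -> R)
  (a_rec : forall k : nat, (1 <= k)%N ->
     a k = (-1) ^+ (k - 1) *
           (4 ^+ k * k%:R / ((2 * k)`!)%:R +
            \sum_(1 <= l < k)
               (-1) ^+ l * 4 ^+ (k - l) / ((2 * k - 2 * l)`!)%:R * a l))
  (k : nat) : (1 <= k)%N -> polynomial_fun (2 * k) (a k) (cot_sum R k).
Proof.
have [m] := ubnP k; elim: m k => // m IHm k; rewrite ltnS => km k1.
apply: (@eq_polynomial_fun _ _ _ (fun n => (-1) ^+ (k - 1) *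
    (k%:R * 'C(2 * n, 2 * k)%:R +
     \sum_(1 <= l < k)
        (-1) ^+ l * ('C(2 * n, 2 * k - 2 * l)%:R * cot_sum R l n)))).
  by move=> n n1; rewrite -cot_sum_rec.
have four j : 2 ^+ (2 * j) = 4 ^+ j :> R by rewrite exprM -natrX.
rewrite a_rec //; apply/polynomial_funZ/polynomial_funD.
  rewrite [4 ^+ k * _]mulrC -mulrA; apply: polynomial_funZ.
  by rewrite -four; exact: polynomial_fun_bin.
apply: polynomial_fun_sum => l; rewrite mem_index_iota => /andP[l1 lk].
rewrite -2!mulrA; apply: polynomial_funZ; rewrite mulrA.
have -> : (2 * k = (2 * k - 2 * l) + 2 * l)%N.
  by rewrite subnK // leq_mul2l ltnW.
rewrite addnK -four mulnBr; apply: polynomial_funM.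
  exact: polynomial_fun_bin.
by apply: IHm => //; exact: leq_trans km.
Qed.

(** Binomial expansion of 1 / sin^(2k) = (1 + cot^2)^k. *)
Lemma csc_sumE (R : realType) (k n : nat) :
  csc_sum R k n = \sum_(0 <= j < k.+1) 'C(k, j)%:R * cot_sum R j n.
Proof.
under eq_bigr => j _ do rewrite mulr_sumr.
rewrite exchange_big /=; apply: eq_big_nat => l /andP[l1 ln].
have [s0 _] := sin_cos_gt0 (angle_itv R l1 ln).
have -> : sin (angle R n l) ^- (2 * k) = (1 + cot (angle R n l) ^+ 2) ^+ k.
  rewrite exprM -exprVn; congr (_ ^+ k).
  rewrite -[1](@mulfV _ (sin (angle R n l) ^+ 2)); last first.
    by rewrite expf_neq0 // lt0r_neq0.
  by rewrite /cot expr_div_n -mulrDl addrC cos2Dsin2 mul1r.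
rewrite exprDn big_mkord; apply: eq_bigr => j _.
by rewrite expr1n mul1r exprM mulr_natl.
Qed.

(** The terms with j < k have degree less than 2k; P_0(n) = n has degree 1,
    which is still less than 2k. *)
Lemma polynomial_csc_sum (R : realType) (a : nat -> R) (k : nat) :
  (forall j, (1 <= j)%N -> polynomial_fun (2 * j) (a j) (cot_sum R j)) ->
  (1 <= k)%N -> polynomial_fun (2 * k) (a k) (csc_sum R k).
Proof.
move=> Pj k1.
apply: (@eq_polynomial_fun _ _ _ (fun n =>
  \sum_(0 <= j < k) 'C(k, j)%:R * cot_sum R j n + cot_sum R k n)).
  by move=> n n1; rewrite csc_sumE big_nat_recr //= binn mul1r.
have -> : a k = \sum_(0 <= j < k) 'C(k, j)%:R * (0 : R) + a k.
  by rewrite big1 ?add0r // => j _; rewrite mulr0.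
apply: polynomial_funD; last exact: Pj.
apply: polynomial_fun_sum => j; rewrite mem_index_iota => /andP[_ jk].
apply: polynomial_funZ; have [->|j0] := posnP j; last first.
  by apply: polynomial_funW (Pj j j0); rewrite ltn_pmul2l.
apply: (polynomial_funW (d := 1) (c := 1)); first by lia.
apply: eq_polynomial_fun polynomial_fun_id => n _.
rewrite /cot_sum; under eq_bigr do rewrite muln0 expr0.
by rewrite big_const_nat subSS subn0 iter_addr_0.
Qed.

(** * The sum over odd integers and zeta *)

(** Mean value theorem on [0, x], as cos <= 1. *)
Lemma sin_le_id (R : realType) (x : R) : 0 <= x -> sin x <= x.
Proof.
move=> x0.
have [c _ E] := @MVT_segment R sin cos 0 x x0 (fun y _ => is_derive_sin y)
  (continuous_subspaceT (@continuous_sin R)).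
rewrite sin0 !subr0 in E; rewrite E -[leRHS]mul1r ler_wpM2r // ?cos_le1.
Qed.

(** Mean value theorem on [0, x], as 1 / cos^2 >= 1. *)
Lemma tan_ge_id (R : realType) (x : R) : 0 <= x < pi / 2 -> x <= tan x.
Proof.
move=> /andP[x0 xp].
have cos0 y : 0 <= y <= x -> 0 < cos y.
  move=> /andP[y0 yx]; rewrite cos_gt0_pihalf // (le_lt_trans yx) // andbT.
  by rewrite (lt_le_trans _ y0) // oppr_lt0 divr_gt0 // pi_gt0.
have [y y0x|y|c c0x E] := @MVT_segment R tan (fun y => (cos y) ^- 2) 0 x x0.
- apply/is_derive_tan/lt0r_neq0/cos0.
  by move: y0x; rewrite in_itv /= => /andP[/ltW -> /ltW ->].
- apply: continuous_in_subspaceT => z; rewrite inE /= in_itv /= => /cos0 cz.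
  exact/continuous_tan/lt0r_neq0.
rewrite tan0 !subr0 in E; rewrite E -[leLHS]mul1r ler_wpM2r //.
have cc : 0 < cos c by apply: cos0; rewrite in_itv /= in c0x.
by rewrite invf_ge1 ?exprn_gt0 // expr_le1 ?ltW // cos_le1.
Qed.

Lemma cot_le_inv_le_csc (R : realType) (x : R) :
  0 < x < pi / 2 -> 0 <= cot x /\ cot x <= x^-1 <= (sin x)^-1.
Proof.
move=> xI; have [s0 c0] := sin_cos_gt0 xI; have /andP[x0 xp] := xI.
split; first by rewrite divr_ge0 // ltW.
apply/andP; split; last by rewrite lef_pV2 ?posrE // sin_le_id ?ltW.
rewrite /cot -invf_div -/(tan x) lef_pV2 ?posrE ?tan_ge_id ?ltW //.
by rewrite divr_gt0.
Qed.

Definition odd_zeta_sum (R : realType) (s n : nat) : R :=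
  \sum_(1 <= l < n.+1) (2 * l%:R - 1) ^- s.

Definition zeta_sum (R : realType) (s n : nat) : R :=
  \sum_(1 <= l < n.+1) l%:R ^- s.

(** The middle term is n^(-2k) times the sum of the theta_l^(-2k), to which the
    termwise bounds cot x <= 1 / x <= 1 / sin x apply. *)
Lemma odd_zeta_sum_bounds (R : realType) (k n : nat) : (1 <= n)%N ->
  cot_sum R k n / n%:R ^+ (2 * k) <=
    (4 / pi) ^+ (2 * k) * odd_zeta_sum R (2 * k) n <=
  csc_sum R k n / n%:R ^+ (2 * k).
Proof.
move=> n1; have n0 : 0 < n%:R :> R by rewrite ltr0n.
have p0 := pi_gt0 R.
have np : 0 < n%:R ^+ (2 * k) :> R by rewrite exprn_gt0.
have -> : (4 / pi) ^+ (2 * k) * odd_zeta_sum R (2 * k) n =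
    (\sum_(1 <= l < n.+1) (angle R n l)^-1 ^+ (2 * k)) / n%:R ^+ (2 * k).
  rewrite mulr_sumr mulr_suml; apply: eq_big_nat => l /andP[l1 ln].
  rewrite -!exprVn -!exprMn; congr (_ ^+ _).
  have lR : (1 : R) <= l%:R by rewrite ler1n.
  (* Without this generalization, [field] unfolds the definition of pi. *)
  rewrite /angle; move: (@pi R) p0 => q q0; field.
  by rewrite !lt0r_neq0 //; lra.
rewrite !ler_pM2r ?invr_gt0 //.
apply/andP; split; apply: ler_sum_nat => l /andP[l1 ln];
  have [c0 /andP[cx xs]] := cot_le_inv_le_csc (angle_itv R l1 ln).
  by rewrite lerXn2r ?nnegrE // (le_trans c0).
by rewrite -exprVn lerXn2r ?nnegrE ?(le_trans c0) // (le_trans cx).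
Qed.

Lemma odd_zeta_sum_cvg (R : realType) (k : nat) (c : R) :
  polynomial_fun (2 * k) c (cot_sum R k) ->
  polynomial_fun (2 * k) c (csc_sum R k) ->
  (odd_zeta_sum R (2 * k) @ \oo --> (pi / 4) ^+ (2 * k) * c)%classic.
Proof.
move=> /polynomial_fun_cvg cotc /polynomial_fun_cvg cscc.
rewrite -cvg_shiftS.
have pn : pi != 0 :> R by rewrite lt0r_neq0 // pi_gt0.
have -> : (fun n => odd_zeta_sum R (2 * k) n.+1) =
  (fun n => (pi / 4) ^+ (2 * k) *
    ((4 / pi) ^+ (2 * k) * odd_zeta_sum R (2 * k) n.+1)).
  apply/funext => n; rewrite mulrA -exprMn.
  by rewrite mulrA divfK ?divff // expr1n mul1r.
apply: cvgMl_tmp; apply: squeeze_cvgr cotc cscc.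
by apply: nearW => n; exact: odd_zeta_sum_bounds.
Qed.

Lemma zeta_sum_even_odd (R : realType) (s n : nat) :
  zeta_sum R s (2 * n) = odd_zeta_sum R s n + 2 ^- s * zeta_sum R s n.
Proof.
elim: n => [|n IHn].
  by rewrite /zeta_sum /odd_zeta_sum !big_geq ?mulr0 ?addr0.
have E2 : (2 * n.+1 = (2 * n).+2)%N by rewrite mulnS add2n.
have -> : zeta_sum R s (2 * n.+1) =
    zeta_sum R s (2 * n) + (2 * n.+1%:R - 1) ^- s + (2 * n.+1%:R) ^- s.
  rewrite /zeta_sum -natrM E2 big_nat_recr //=.
  rewrite [X in X + _ = _]big_nat_recr //=; congr (_ + _ ^- s + _).
  by rewrite -!natr1 natrM; ring.
have recr (F : nat -> R) :
  \sum_(1 <= l < n.+2) F l = \sum_(1 <= l < n.+1) F l + F n.+1.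
  by rewrite big_nat_recr.
rewrite IHn /odd_zeta_sum /zeta_sum !recr exprMn invfM.
by ring.
Qed.

Lemma odd_zeta_sum_le_lim (R : realType) (s : nat) (L : R) :
  (odd_zeta_sum R s @ \oo --> L)%classic ->
  forall n, odd_zeta_sum R s n <= L.
Proof.
move=> oL n; have := @nondecreasing_cvgn_le R (odd_zeta_sum R s).
rewrite (cvg_lim _ oL) //; apply; last exact: oL.
apply/nondecreasing_seqP => m; rewrite /odd_zeta_sum [leRHS]big_nat_recr //=.
by rewrite lerDl invr_ge0 exprn_ge0.
Qed.

(** Splitting even and odd indices, T(2n) = O(n) + 2^(-s) T(n) for the partial
    sums T of zeta(s) and O of the odd part. As T(n) <= T(2n), this bounds the
    nondecreasing T, which thus converges, and in the limit it determines
    zeta(s). *)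
Lemma zeta_of_odd_sum (R : realType) (s : nat) (L : R) : (1 <= s)%N ->
  (odd_zeta_sum R s @ \oo --> L)%classic ->
  zeta R s = (L / (1 - 2 ^- s))%:E.
Proof.
move=> s1 oL; set T := zeta_sum R s.
have q1 : 2 ^- s < 1 :> R.
  by rewrite invf_lt1 ?exprn_gt0 // exprn_egt1 -?lt0n ?ltr1n.
have q0 : 0 < 1 - 2 ^- s :> R by rewrite subr_gt0.
have odd_le := odd_zeta_sum_le_lim oL.
have T_nd : {homo T : n m / (n <= m)%N >-> n <= m}.
  apply/nondecreasing_seqP => m; rewrite /T /zeta_sum [leRHS]big_nat_recr //=.
  by rewrite lerDl invr_ge0 exprn_ge0.
have T_le n : T n <= L / (1 - 2 ^- s).
  have T2 : T n <= T (2 * n)%N by apply: T_nd; rewrite leq_pmull.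
  rewrite ler_pdivlMr // mulrBr mulr1 lerBlDr (le_trans T2) //.
  by rewrite /T zeta_sum_even_odd mulrC lerD2r.
have /cvg_ex[t Tt] : cvgn T.
  apply: (nondecreasing_is_cvgn T_nd).
  by exists (L / (1 - 2 ^- s)) => _ [n _ <-].
have tE : t = L / (1 - 2 ^- s).
  have T2t : (T (2 * n)%N @[n --> \oo] --> t)%classic.
    exact: cvg_comp (@cvg_mulnl 2 isT) Tt.
  have oL' : (odd_zeta_sum R s @ \oo --> t - 2 ^- s * t)%classic.
    have -> : odd_zeta_sum R s =
        (fun n => T (2 * n)%N) - (fun n => 2 ^- s * T n).
      by apply/funext => n; rewrite /T !fctE zeta_sum_even_odd addrK.
    by apply: cvgB => //; apply: cvgMl_tmp.
  have -> : L = t - 2 ^- s * t by apply: cvg_unique oL oL'.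
  by rewrite -[X in X - _]mul1r -mulrBl mulrAC mulfV ?mul1r // lt0r_neq0.
rewrite /zeta -tE; apply: cvg_lim => //; rewrite -cvg_shiftS.
apply: cvg_EFin; first by apply: nearW => n; rewrite /= sumEFin.
by under eq_fun do rewrite /= sumEFin.
Qed.

(** * Exact degree and the value of zeta *)

Lemma polynomial_fun_degree (K : idomainType) (d : nat) (c : K)
    (f : nat -> K) : c != 0 -> polynomial_fun d c f ->
  exists p : {poly K}, [/\ size p = d.+1, lead_coef p = c
    & forall n : nat, (1 <= n)%N -> f n = p.[n%:R]].
Proof.
move=> c0 [p [sp pd pf]]; exists p.
have sz : size p = d.+1.
  apply/eqP; rewrite eqn_leq sp ltnNge; apply: contra c0 => le_pd.
  by rewrite -pd nth_default.
by split; rewrite // lead_coefE sz.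
Qed.

Theorem mainTheorem1 (R : realType) (a : nat -> R)
  (a_rec : forall k : nat, (1 <= k)%N ->
     a k = (-1) ^+ (k - 1) *
           (4 ^+ k * k%:R / ((2 * k)`!)%:R +
            \sum_(1 <= l < k)
               (-1) ^+ l * 4 ^+ (k - l) / ((2 * k - 2 * l)`!)%:R * a l))
  (k : nat) (k_ge1 : (1 <= k)%N) :
  [/\ exists p : {poly R},
        [/\ size p = (2 * k).+1,
            lead_coef p = a k
          & forall n : nat, (1 <= n)%N ->
              \sum_(1 <= l < n.+1)
                 cot ((2 * l%:R - 1) / (4 * n%:R) * pi) ^+ (2 * k)
              = p.[n%:R]],
      exists q : {poly R},
        [/\ size q = (2 * k).+1,
            lead_coef q = a k
          & forall n : nat, (1 <= n)%N ->
              \sum_(1 <= l < n.+1)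
                 sin ((2 * l%:R - 1) / (4 * n%:R) * pi) ^- (2 * k)
              = q.[n%:R]]
    & zeta R (2 * k) = (pi ^+ (2 * k) / (4 ^+ (2 * k) - 4 ^+ k) * a k)%:E].
Proof.
have Pj := polynomial_cot_sum a_rec.
have Pk := Pj k k_ge1.
have Qk := polynomial_csc_sum Pj k_ge1.
have oddL := odd_zeta_sum_cvg Pk Qk.
(* The first partial sum over odd integers is 1. *)
have a0 : a k != 0.
  have := odd_zeta_sum_le_lim oddL 1; rewrite /odd_zeta_sum big_nat1.
  rewrite mulr1 -[2]natr1 addrK expr1n invr1; apply: contraTneq => ->.
  by rewrite mulr0 ler10.
split; [exact: polynomial_fun_degree Pk | exact: polynomial_fun_degree Qk |].
rewrite (zeta_of_odd_sum _ oddL); last by rewrite muln_gt0.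
have four : 2 ^+ (2 * k) = 4 ^+ k :> R by rewrite exprM -natrX.
have four_gt1 : 1 < 4 ^+ k :> R by rewrite exprn_egt1 -?lt0n ?ltr1n.
congr (_%:E); rewrite four expr_div_n [(2 * k)%N]mulnC exprM.
rewrite [4 ^+ (k * 2)]exprM.
move: (4 ^+ k) four_gt1 => q q1; move: (@pi R ^+ k ^+ 2) => u.
by field; rewrite !lt0r_neq0 //; nra.
Qed.
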